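(* Let $\alpha\in(0,2)$. The frequency map $j\mapsto\omega_\alpha(j)=j\,L_\alpha(|j|)$, $j\in\mathbb Z$, is odd and satisfies the convexity property $$\omega_\alpha(j+1)+\omega_\alpha(j-1)-2\omega_\alpha(j)=\frac{\Gamma(2-\alpha)}{2^{1-\alpha}\,\Gamma(1-\frac\alpha2)^2}\,\frac{\Gamma(\frac\alpha2-1+j)}{\Gamma(2-\frac\alpha2+j)}\,\alpha j>0,\qquad\forall j\ge1 .$$ The linear frequencies $\omega_\alpha(j)$ are different from zero for any $|j|\ge2$; in particular $\omega_\alpha(j)>0$ and increasing for any $j\ge2$.
   Context: For $j\in\mathbb Z$, $$L_\alpha(|j|)=\frac{c_\alpha}{2(1-\frac\alpha2)}\Big[\mathsf T^1_\alpha(|j|)-\mathsf T^2_\alpha(|j|)-\frac{\Gamma(2-\alpha)}{\Gamma(1-\frac\alpha2)^2}\Big],\qquad c_\alpha=\frac{\Gamma(\frac\alpha2)}{2^{1-\alpha}\Gamma(1-\frac\alpha2)},$$ $$\mathsf T^1_\alpha(|j|)=\frac{\Gamma(2-\alpha)}{\Gamma(1-\frac\alpha2)\Gamma(\frac\alpha2)}\sum_{k=0}^{|j|-1}\frac{\Gamma(\frac\alpha2+k)}{\Gamma(1-\frac\alpha2+k)}\,\frac1{1-\frac\alpha2+k},\quad \mathsf T^1_\alpha(0)=0,\qquad \mathsf T^2_\alpha(|j|)=\frac{\Gamma(2-\alpha)}{\Gamma(1-\frac\alpha2)\Gamma(\frac\alpha2)}\,\frac{\Gamma(\frac\alpha2+|j|)}{\Gamma(1-\frac\alpha2+|j|)},$$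 and $\Gamma$ is the Euler Gamma function. *)

(* Defs.v *)
From HB Require Import structures.
From mathcomp Require Import all_boot all_order all_algebra.
From mathcomp Require Import all_classical all_reals all_analysis.
Set Implicit Arguments.
Unset Strict Implicit.
Unset Printing Implicit Defensive.
Import Order.TTheory GRing.Theory Num.Theory.
Import numFieldNormedType.Exports.
Local Open Scope classical_set_scope.
Local Open Scope ring_scope.

(* Euler's Gamma function, by Euler's integral of the second kind; this is the
   Gamma function only for s > 0 (the meromorphic continuation to s <= 0 is not
   covered).  For 0 < alpha < 2, every argument of Gamma below, and in the
   convexity formula with j >= 1, is positive. *)
Definition Gamma (R : realType) (s : R) : R :=
  Rintegral (@lebesgue_measure R) `]0, +oo[
    (fun t : R => t `^ (s - 1) * expR (- t)).

Definition c_ (R : realType) (alpha : R) : R :=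
  Gamma (alpha / 2) / (2 `^ (1 - alpha) * Gamma (1 - alpha / 2)).

Definition T1 (R : realType) (alpha : R) (n : nat) : R :=
  Gamma (2 - alpha) / (Gamma (1 - alpha / 2) * Gamma (alpha / 2)) *
  \sum_(0 <= k < n)
     (Gamma (alpha / 2 + k%:R) / Gamma (1 - alpha / 2 + k%:R) *
      (1 / (1 - alpha / 2 + k%:R))).

Definition T2 (R : realType) (alpha : R) (n : nat) : R :=
  Gamma (2 - alpha) / (Gamma (1 - alpha / 2) * Gamma (alpha / 2)) *
  (Gamma (alpha / 2 + n%:R) / Gamma (1 - alpha / 2 + n%:R)).

Definition L_ (R : realType) (alpha : R) (n : nat) : R :=
  c_ alpha / (2 * (1 - alpha / 2)) *
  (T1 alpha n - T2 alpha n - Gamma (2 - alpha) / Gamma (1 - alpha / 2) ^+ 2).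

Definition omega (R : realType) (alpha : R) (j : int) : R :=
  j%:~R * L_ alpha `|j|%N.

(* Main.v *)
(* With a = alpha / 2 and h n = Gamma (a + n) / Gamma (2 - a + n), the functional
   equation of Gamma gives L (n + 1) - L n = C h n with a constant C > 0, together
   with L 1 = 0.  Hence L is increasing and positive from n = 2 on, and the second
   difference of n L n is C ((n + 1) h n - (n - 1) h (n - 1)), which simplifies by
   the functional equation again.

   The functional equation comes from integrating the derivative of t^s e^(-t)
   over [1/N, N] and letting N go to infinity, in the extended reals since
   convergence of the integral is not known yet.  For s > 1 the integral of
   t^(s-1) e^(-t) is finite since the integrand is dominated by a multiple of
   e^(-t/2); the singular range s <= 1 then follows from the functional equation. *)
Require Import Defs.
From HB Require Import structures.
From mathcomp Require Import all_boot all_order all_algebra.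
From mathcomp Require Import all_classical all_reals all_analysis.
From mathcomp Require Import measurable_realfun.
From mathcomp Require Import ring lra zify.
Import Order.TTheory GRing.Theory Num.Theory.
Import numFieldNormedType.Exports.
Local Open Scope ring_scope.

(* The exponent is shifted by one: the integrand of [Gamma s] is
   [gamma_kernel (s - 1)]. *)
Definition gamma_kernel {R : realType} (s t : R) : R := t `^ s * expR (- t).

Lemma gamma_kernel_ge0 {R : realType} (s t : R) : 0 <= gamma_kernel s t.
Proof. by rewrite mulr_ge0 ?powR_ge0 ?expR_ge0. Qed.

Lemma measurable_gamma_kernel {R : realType} (s : R) (D : set R) :
  measurable_fun D (gamma_kernel s).
Proof.
apply: measurable_funTS; apply: measurable_funM; first exact: measurable_powR.
by apply: measurableT_comp => //; exact: measurable_expR.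
Qed.

Lemma is_derive_gamma_kernel {R : realType} (s : R) {t : R} : 0 < t ->
  is_derive t 1 (gamma_kernel s)
    (s * gamma_kernel (s - 1) t - gamma_kernel s t).
Proof.
move=> t0.
have dp := is_derive1_powR s t0.
have de : is_derive t 1 (fun x : R => expR (- x)) (- expR (- t)).
  rewrite -mulrN1; have /is_derive1_comp := is_derive_expR (- t); apply.
have /is_derive_eq := is_deriveM dp de; apply.
by rewrite /gamma_kernel /= /GRing.scale /=; ring.
Qed.

(** Apply $1+x\le e^x$ at $x=t/(2s)$ and raise to the power $s$: this costs $e^{t/2}$ and leaves
    half of the decay of $e^{-t}$. *)
Lemma gamma_kernel_le {R : realType} {s t : R} : 0 < s -> 0 <= t ->
  gamma_kernel s t <= (2 * s) `^ s * expR (- (1 / 2) * t).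
Proof.
move=> s0 t0.
have s20 : 0 < 2 * s by rewrite mulr_gt0.
have x0 : 0 <= t / (2 * s) by rewrite divr_ge0// ltW.
have -> : gamma_kernel s t = (2 * s) `^ s * (t / (2 * s)) `^ s * expR (- t).
  by rewrite -powRM ?(ltW s20)// mulrCA divff ?gt_eqF// mulr1.
rewrite -mulrA ler_wpM2l ?powR_ge0//.
have -> : - (1 / 2) * t = t / (2 * s) * s - t by field; rewrite gt_eqF.
rewrite expRD ler_wpM2r ?expR_ge0// expRM.
rewrite ge0_ler_powR ?nnegrE ?expR_ge0 ?(ltW s0)//.
by apply: le_trans (expR_ge1Dx _); rewrite lerDr.
Qed.

(** The shift by 2 keeps the endpoints distinct already at [n = 0]; the positive left end avoids the
    singularity at 0. *)
Definition exhaust {R : realType} (n : nat) : interval R := `[n.+2%:R^-1, n.+2%:R].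

Lemma bigcup_exhaust {R : realType} :
  (\bigcup_n [set` exhaust n])%classic = `]0, +oo[%classic :> set R.
Proof.
apply/seteqP; split => [x [n _] /=|x /=].
  by rewrite !in_itv/= andbT => /andP[+ _]; apply: lt_le_trans; rewrite invr_gt0.
rewrite in_itv/= andbT => x0.
have /archi_boundP := ltW x0; set m := Num.bound x => xm.
have /archi_boundP : 0 <= x^-1 by rewrite invr_ge0 ltW.
set k := Num.bound _ => xk.
(* [m] bounds [x] and [k] bounds its inverse, so the index [m + k] serves both ends. *)
exists (m + k)%N => //=; rewrite in_itv/=; apply/andP; split.
  rewrite -[leRHS]invrK lef_pV2 ?posrE ?invr_gt0//.
  by apply: le_trans (ltW xk) _; rewrite ler_nat; lia.
by apply: le_trans (ltW xm) _; rewrite ler_nat; lia.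
Qed.

(** * Functional equation, finiteness and positivity of Gamma *)

Section gamma.
Context {R : realType}.
Notation mu := (@lebesgue_measure R).
Local Open Scope classical_set_scope.
Implicit Types s : R.

(** Kept in the extended reals: [fine] would send an infinite integral to 0, so [Gamma] is
    informative only once finiteness is known. *)
Definition egamma s : \bar R :=
  (\int[mu]_(t in `]0%R, +oo[) (gamma_kernel (s - 1) t)%:E)%E.

Lemma GammaE s : Gamma s = fine (egamma s).
Proof. by []. Qed.

(** Monotone convergence along growing intervals, valid even when the limit is infinite. *)
Lemma exhaust_cvg s :
  (\int[mu]_(t in [set` exhaust n]) (gamma_kernel s t)%:E @[n --> \oo] -->
   \int[mu]_(t in `]0%R, +oo[) (gamma_kernel s t)%:E)%E.
Proof.
rewrite -bigcup_exhaust; apply: ge0_nondecreasing_set_cvg_integral => //.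
- move=> m n mn; rewrite subsetEset; apply: subset_itv; rewrite bnd_simp.
    by rewrite lef_pV2 ?posrE// ler_nat; lia.
  by rewrite ler_nat; lia.
- by move=> n; apply/measurable_EFinP; exact: measurable_gamma_kernel.
- by move=> n x _; rewrite lee_fin gamma_kernel_ge0.
Qed.

Lemma gamma_kernel_cvg0 {s} : 0 < s ->
  gamma_kernel s n.+2%:R^-1 @[n --> \oo] --> (0 : R).
Proof.
move=> s0.
have c : (n.+2%:R^-1 : R) @[n --> \oo] --> (0 : R).
  by have := @cvg_harmonic R; rewrite -cvg_shiftS.
have c' : (n.+2%:R^-1 : R) `^ s @[n --> \oo] --> (0 : R).
  move/cvg_at_rightP : (powR_cvg0 s0).
  by apply; split => // n; rewrite invr_gt0.
apply: (squeeze_cvgr _ (@cvg_cst _ (0 : R) _ _ _) c').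
near=> n; rewrite gamma_kernel_ge0/= ler_piMr ?powR_ge0//.
Unshelve. all: by end_near. Qed.

Lemma gamma_kernel_cvgy {s} : 0 < s ->
  gamma_kernel s n.+2%:R @[n --> \oo] --> (0 : R).
Proof.
move=> s0.
have c : expR (- ((1 / 2) * n.+2%:R)) @[n --> \oo] --> (0 : R).
  apply: (@cvg_comp _ _ _ (fun n : nat => 1 / 2 * n.+2%:R : R) (fun x => expR (- x))
    _ (pinfty_nbhs R)); last exact: cvgr_expR.
  apply/cvgryPge => A; near=> n.
  have : 2 * A <= n%:R by near: n; exact: nbhs_infty_ger.
  by rewrite -[n.+2]addn2 natrD; lra.
have c' : (2 * s) `^ s * expR (- ((1 / 2) * n.+2%:R)) @[n --> \oo] --> (0 : R).
  by rewrite -(mulr0 ((2 * s) `^ s)); apply: cvgM => //; exact: cvg_cst.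
apply: (squeeze_cvgr _ (@cvg_cst _ (0 : R) _ _ _) c').
near=> n; rewrite gamma_kernel_ge0/=.
by apply: le_trans (gamma_kernel_le s0 _) _ => //; rewrite mulNr.
Unshelve. all: by end_near. Qed.

(** The fundamental theorem of calculus for $t^s e^{-t}$, arranged so that no two integrals are
    subtracted in the limit. *)
Lemma integral_exhaust s n :
  (s%:E * \int[mu]_(t in [set` exhaust n]) (gamma_kernel (s - 1) t)%:E =
   \int[mu]_(t in [set` exhaust n]) (gamma_kernel s t)%:E +
   (gamma_kernel s n.+2%:R - gamma_kernel s n.+2%:R^-1)%:E)%E.
Proof.
have ab : n.+2%:R^-1 < n.+2%:R :> R.
  by rewrite (@lt_trans _ _ 1)// ?invf_lt1// ltr1n.
have pos x : n.+2%:R^-1 <= x -> 0 < x :> R.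
  by apply: lt_le_trans; rewrite invr_gt0.
have ck (r : R) : {within [set` exhaust n], continuous (gamma_kernel r)}.
  apply: derivable_within_continuous => x; rewrite in_itv/= => /andP[/pos x0 _].
  exact: (@ex_derive _ _ _ _ _ _ _ (is_derive_gamma_kernel r x0)).
have ik (r : R) : mu.-integrable [set` exhaust n] (EFin \o gamma_kernel r).
  by apply: continuous_compact_integrable; [exact: segment_compact|exact: ck].
pose f t := s * gamma_kernel (s - 1) t - gamma_kernel s t.
have csk : {within [set` exhaust n], continuous (fun t => s * gamma_kernel (s - 1) t)}.
  by move=> x; apply: cvgM; [exact: cvg_cst|exact: ck].
have cf : {within [set` exhaust n], continuous f}.
  by move=> x; apply: cvgB; [exact: csk|exact: ck].
have cx x : n.+2%:R^-1 <= x -> {for x, continuous (gamma_kernel s)}.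
  move=> /pos x0; apply/differentiable_continuous/derivable1_diffP.
  exact: (@ex_derive _ _ _ _ _ _ _ (is_derive_gamma_kernel s x0)).
have := @continuous_FTC2 R f (gamma_kernel s) _ _ ab cf.
rewrite -EFinB => <-; last 2 first.
- split.
  + move=> x; rewrite in_itv/= => /andP[/ltW /pos x0 _].
    exact: (@ex_derive _ _ _ _ _ _ _ (is_derive_gamma_kernel s x0)).
  + by apply: cvg_at_right_filter; exact: cx.
  + by apply: cvg_at_left_filter; apply: cx; exact: ltW.
- move=> x; rewrite in_itv/= => /andP[/ltW /pos x0 _].
  by rewrite derive1E; have [_ ->] := is_derive_gamma_kernel s x0.
under [X in (_ + X)%E]eq_integral do rewrite EFinB.
rewrite integralB_EFin//; last first.
  by apply: continuous_compact_integrable; [exact: segment_compact|exact: csk].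
(* The integral being cancelled is finite, since the kernel is continuous on a compact interval. *)
rewrite addeCA subee ?adde0; last by apply: integrable_fin_num => //; exact: ik.
by rewrite -integralZl//; exact: ik.
Qed.

Lemma egammaD1 {s} : 0 < s -> (egamma (s + 1) = s%:E * egamma s)%E.
Proof.
move=> s0; rewrite /egamma addrK.
have cl := cvgeZl (isT : s%:E \is a fin_num) (exhaust_cvg (s - 1)).
have cF : (gamma_kernel s n.+2%:R - gamma_kernel s n.+2%:R^-1)%:E @[n --> \oo] -->
    (0 : \bar R)%E.
  apply: cvg_EFin; first exact: nearW.
  rewrite -(subr0 0).
  by apply: cvgB; [exact: gamma_kernel_cvgy|exact: gamma_kernel_cvg0].
(* The finite limit 0 of the boundary terms rules out $\infty-\infty$. *)
have cr := cvgeD (fin_num_adde_defl _ (isT : (0 : \bar R)%E \is a fin_num))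
  (exhaust_cvg s) cF.
rewrite adde0 in cr.
move: cl; under eq_fun do rewrite integral_exhaust.
by move=> cl; apply: cvg_unique (cr _) cl; exact: ereal_hausdorff.
Qed.

Lemma egammaD1_lty {s} : 0 < s -> (egamma (s + 1) < +oo)%E.
Proof.
move=> s0; rewrite /egamma addrK.
(* The factor 2 offsets the rate $1/2$ in the exponential density, which serves as integrable
   majorant. *)
pose C := 2 * (2 * s) `^ s.
have rate0 : (0 : R) < 1 / 2 by [].
have iC : mu.-integrable `]0%R, +oo[
    (fun t => (C%:E * (exponential_pdf (1 / 2) t)%:E)%E).
  apply: integrableZl => //.
  by apply: integrableS (integrable_exponential_pdf rate0).
apply: le_lt_trans (integrable_lty _ iC) => //.
apply: ge0_le_integral => //.
- by move=> t _; rewrite lee_fin gamma_kernel_ge0.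
- apply/measurable_EFinP; exact: measurable_gamma_kernel.
- exact: measurable_int iC.
move=> t /=; rewrite in_itv/= andbT => t0.
rewrite -EFinM lee_fin exponential_pdfE ?(ltW t0)//.
apply: le_trans (gamma_kernel_le s0 (ltW t0)) _.
by rewrite le_eqVlt; apply/orP; left; apply/eqP; rewrite /C; field.
Qed.

Lemma egamma_ge0 s : (0 <= egamma s)%E.
Proof. by apply: integral_ge0 => t _; rewrite lee_fin gamma_kernel_ge0. Qed.

(** An infinite value at $s$ would, multiplied by $s>0$, give an infinite value at $s+1$. *)
Lemma egamma_fin_num {s} : 0 < s -> egamma s \is a fin_num.
Proof.
move=> s0; rewrite ge0_fin_numE ?egamma_ge0//.
have := egammaD1_lty s0; rewrite egammaD1//.
case: (egamma s) (egamma_ge0 s) => [r _ _|_|//]; first exact: ltry.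
by rewrite gt0_muley// lte_fin.
Qed.

Lemma GammaD1 {s} : 0 < s -> Gamma (s + 1) = s * Gamma s.
Proof. by move=> s0; rewrite !GammaE egammaD1// fineM ?egamma_fin_num. Qed.

Lemma GammaDS {s} n : 0 < s ->
  Gamma (s + n.+1%:R) = (s + n%:R) * Gamma (s + n%:R).
Proof. by move=> s0; rewrite -natr1 addrA GammaD1// ltr_wpDr. Qed.

Lemma Gamma_gt0 {s} : 0 < s -> 0 < Gamma s.
Proof.
move=> s0; rewrite GammaE fine_gt0// -ge0_fin_numE ?egamma_ge0// egamma_fin_num// andbT.
(* Lower bound on $[1,2]$ for every $s>0$: $t^{s-1}\ge t^{-1}\ge 1/2$ and $e^{-t}\ge e^{-2}$. *)
pose c : R := 2^-1 * expR (- 2).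
have c0 : 0 < c by rewrite mulr_gt0 ?expR_gt0.
apply: (@lt_le_trans _ _ (\int[mu]_(t in `[1%R, 2%R]) (cst c%:E) t)%E).
  rewrite integral_cst//= lebesgue_measure_itv/= lte_fin ltr1n/=.
  by rewrite -EFinB -EFinM lte_fin mulr_gt0//; lra.
apply: (@le_trans _ _ (\int[mu]_(t in `[1%R, 2%R]) (gamma_kernel (s - 1) t)%:E)%E).
  apply: ge0_le_integral => //.
  - by move=> t _; rewrite lee_fin ltW.
  - apply/measurable_EFinP; exact: measurable_gamma_kernel.
  move=> t /=; rewrite in_itv/= => /andP[t1 t2].
  rewrite lee_fin ler_pM ?expR_ge0 ?ler_expR ?lerN2//.
  apply: (@le_trans _ _ (t `^ (- 1))); last by apply: ler_powR => //; lra.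
  by rewrite powR_inv1 ?lef_pV2 ?posrE//; lra.
apply: ge0_subset_integral => //.
- apply/measurable_EFinP; exact: measurable_gamma_kernel.
- by move=> t _; rewrite lee_fin gamma_kernel_ge0.
- by move=> t /=; rewrite !in_itv/= andbT => /andP[+ _]; exact: lt_le_trans.
Qed.

End gamma.

(** * Recurrence for [L_] and properties of the frequencies *)

Section frequencies.
Context {R : realType}.
Implicit Types alpha : R.

Definition convexity_const alpha : R :=
  Gamma (2 - alpha) / (2 `^ (1 - alpha) * Gamma (1 - alpha / 2) ^+ 2).

(** The sequence [h] above; by the functional equation it is also the summand of [T1]. *)
Definition Gamma_ratio alpha (n : nat) : R :=
  Gamma (alpha / 2 + n%:R) / Gamma (2 - alpha / 2 + n%:R).

Lemma convexity_const_gt0 {alpha} : alpha < 2 -> 0 < convexity_const alpha.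
Proof.
by move=> a2; rewrite divr_gt0 ?mulr_gt0 ?powR_gt0 ?exprn_gt0 ?Gamma_gt0//; lra.
Qed.

Lemma Gamma_ratio_gt0 {alpha} n : 0 < alpha < 2 -> 0 < Gamma_ratio alpha n.
Proof.
move=> /andP[a0 a2]; have n0 : 0 <= n%:R :> R by [].
by rewrite divr_gt0 ?Gamma_gt0//; lra.
Qed.

Lemma Gamma_ratioS alpha n : 0 < alpha < 2 ->
  Gamma_ratio alpha n.+1 =
  (alpha / 2 + n%:R) / (2 - alpha / 2 + n%:R) * Gamma_ratio alpha n.
Proof.
move=> /andP[a0 a2]; have n0 : 0 <= n%:R :> R by [].
have sb : 0 < 2 - alpha / 2 by lra.
have gd : 0 < Gamma (2 - alpha / 2 + n%:R) by apply: Gamma_gt0; rewrite ltr_wpDr.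
rewrite /Gamma_ratio (GammaDS n sb) GammaDS; last lra.
move: gd (Gamma _) => /[swap] g; move: (Gamma _) => d d0.
by field; rewrite !gt_eqF//=; lra.
Qed.

(** Write $a=\alpha/2$. Up to their common prefactor, [T1] grows by $h(n)$ and [T2] by $(2a-1)h(n)$;
    the difference $2(1-a)h(n)$ cancels the denominator in [L_]. *)
Lemma L_S {alpha} n : 0 < alpha < 2 ->
  L_ alpha n.+1 = L_ alpha n + convexity_const alpha * Gamma_ratio alpha n.
Proof.
move=> /andP[a0 a2]; have n0 : 0 <= n%:R :> R by [].
have sa : 0 < alpha / 2 by lra.
have sb : 0 < 1 - alpha / 2 by lra.
have p0 : 0 < (2 : R) `^ (1 - alpha) by rewrite powR_gt0.
have ga := Gamma_gt0 sa.
have gb := Gamma_gt0 sb.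
have gd : 0 < Gamma (1 - alpha / 2 + n%:R) by apply: Gamma_gt0; rewrite ltr_wpDr.
rewrite /L_ /T1 big_nat_recr//= /T2 /c_ /convexity_const /Gamma_ratio.
rewrite (_ : 2 - alpha / 2 + n%:R = 1 - alpha / 2 + n.+1%:R); last first.
  by rewrite -natr1; ring.
rewrite (GammaDS n sa) (GammaDS n sb).
(* With the sum, the power and the Gamma values turned into variables, a rational identity remains
   for [field]. *)
move: (\sum_(0 <= k < n) _) p0 ga gb gd => S.
move: (2 `^ _) (Gamma (alpha / 2)) (Gamma (1 - alpha / 2)) (Gamma (2 - alpha)).
move: (Gamma (1 - alpha / 2 + _)) (Gamma (alpha / 2 + _)) => d u p ga gb g2.
move=> p0 ga0 gb0 d0.
by field; rewrite !gt_eqF//=; lra.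
Qed.

(** At $n=1$ the difference [T1 - T2] equals exactly the constant subtracted in [L_]. *)
Lemma L_1 {alpha} : 0 < alpha < 2 -> L_ alpha 1 = 0.
Proof.
move=> /andP[a0 a2].
have sa : 0 < alpha / 2 by lra.
have sb : 0 < 1 - alpha / 2 by lra.
have p0 : 0 < (2 : R) `^ (1 - alpha) by rewrite powR_gt0.
have ga := Gamma_gt0 sa.
have gb := Gamma_gt0 sb.
rewrite /L_ /T1 big_nat1 /T2 /c_ !addr0 (GammaD1 sa) (GammaD1 sb).
move: p0 ga gb; move: (2 `^ _) (Gamma (alpha / 2)) (Gamma (1 - alpha / 2)).
move: (Gamma (2 - alpha)) => g2 p ga gb p0 ga0 gb0.
by field; rewrite !gt_eqF//=; lra.
Qed.

Lemma L_lt {alpha} : 0 < alpha < 2 -> {homo L_ alpha : m n / (m < n)%N >-> m < n}.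
Proof.
move=> a02; apply: homo_ltn => [|n]; first exact: lt_trans.
rewrite (L_S n a02) ltrDl; apply: mulr_gt0; last exact: Gamma_ratio_gt0.
by case/andP: a02 => _; exact: convexity_const_gt0.
Qed.

Lemma L_gt0 {alpha} n : 0 < alpha < 2 -> (1 < n)%N -> 0 < L_ alpha n.
Proof. by move=> a02 n1; rewrite -(L_1 a02); exact: L_lt. Qed.

Lemma omega_nat alpha (n : nat) : omega alpha n = n%:R * L_ alpha n.
Proof. by []. Qed.

Lemma omegaN alpha (j : int) : omega alpha (- j) = - omega alpha j.
Proof. by rewrite /omega abszN rmorphN mulNr. Qed.

Lemma omega_gt0 {alpha} (j : int) : 0 < alpha < 2 -> 2 <= j -> 0 < omega alpha j.
Proof.
case: j => // n a02 n2.
by rewrite omega_nat mulr_gt0 ?ltr0n ?L_gt0//; lia.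
Qed.

(** Both factors of $nL(n)$ are nonnegative and strictly increasing from $n=2$ on. *)
Lemma omega_lt {alpha} (j k : int) : 0 < alpha < 2 -> 2 <= j -> j < k ->
  omega alpha j < omega alpha k.
Proof.
case: j k => // m [] // n a02 m2 mn.
by rewrite !omega_nat ltr_pM ?ltr_nat ?L_lt ?ler0n// ltW// L_gt0.
Qed.

Lemma omega_neq0 {alpha} (j : int) : 0 < alpha < 2 -> 2 <= `|j| -> omega alpha j != 0.
Proof.
move=> a02; case: (lerP 0 j) => j0; [rewrite ger0_norm// | rewrite ltr0_norm//] => j2.
  by apply: lt0r_neq0; exact: omega_gt0.
by rewrite -oppr_eq0 -omegaN; apply: lt0r_neq0; exact: omega_gt0.
Qed.

(** With $j=n+1$ and $a=\alpha/2$, the simplification rests on $(n+2)(a+n)-n(2-a+n)=2a(n+1)=\alpha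
    j$. *)
Lemma omega_convex {alpha} (j : int) : 0 < alpha < 2 -> 1 <= j ->
  omega alpha (j + 1) + omega alpha (j - 1) - 2 * omega alpha j =
  convexity_const alpha *
  (Gamma (alpha / 2 - 1 + j%:~R) / Gamma (2 - alpha / 2 + j%:~R)) *
  (alpha * j%:~R).
Proof.
case: j => // -[//|n] a02 _.
have -> : (n.+1 : int) + 1 = n.+2 by lia.
have -> : (n.+1 : int) - 1 = n by lia.
rewrite !omega_nat (L_S n.+1)// (L_S n)// Gamma_ratioS//.
have /andP[a0 a2] := a02; have n0 : 0 <= n%:R :> R by [].
have sb : 0 < 2 - alpha / 2 by lra.
have gd : 0 < Gamma (2 - alpha / 2 + n%:R) by apply: Gamma_gt0; rewrite ltr_wpDr.
rewrite -[n.+1%:~R]/(n.+1%:R : R) (GammaDS n sb).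
rewrite (_ : alpha / 2 - 1 + n.+1%:R = alpha / 2 + n%:R); last first.
  by rewrite -natr1; ring.
rewrite -(natr1 n.+1) -(natr1 n) /Gamma_ratio.
move: gd; move: (convexity_const _) (L_ _ _) (Gamma (alpha / 2 + _)) (Gamma _).
move=> D L u d d0.
by field; rewrite !gt_eqF//=; lra.
Qed.

(** The bound $j\ge1$ keeps the argument $\alpha/2-1+j$ of Gamma at least $\alpha/2>0$. *)
Lemma omega_convex_gt0 {alpha} (j : int) : 0 < alpha < 2 -> 1 <= j ->
  0 < convexity_const alpha *
      (Gamma (alpha / 2 - 1 + j%:~R) / Gamma (2 - alpha / 2 + j%:~R)) *
      (alpha * j%:~R).
Proof.
move=> /andP[a0 a2] j1; have j1' : 1 <= j%:~R :> R by rewrite ler1z.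
apply: mulr_gt0; last by apply: mulr_gt0; lra.
apply: mulr_gt0; first exact: convexity_const_gt0.
by apply: divr_gt0; apply: Gamma_gt0; lra.
Qed.

End frequencies.

Theorem lemma3p4 (R : realType) (alpha : R) (halpha : 0 < alpha < 2) :
  [/\ forall j : int, omega alpha (- j) = - omega alpha j,
      forall j : int, 1 <= j ->
        omega alpha (j + 1) + omega alpha (j - 1) - 2 * omega alpha j =
          Gamma (2 - alpha) / (2 `^ (1 - alpha) * Gamma (1 - alpha / 2) ^+ 2) *
          (Gamma (alpha / 2 - 1 + j%:~R) / Gamma (2 - alpha / 2 + j%:~R)) *
          (alpha * j%:~R)
        /\
        0 < Gamma (2 - alpha) / (2 `^ (1 - alpha) * Gamma (1 - alpha / 2) ^+ 2) *
            (Gamma (alpha / 2 - 1 + j%:~R) / Gamma (2 - alpha / 2 + j%:~R)) *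
            (alpha * j%:~R),
      forall j : int, 2 <= `|j| -> omega alpha j != 0,
      forall j : int, 2 <= j -> 0 < omega alpha j
    & forall j k : int, 2 <= j -> j < k -> omega alpha j < omega alpha k].
Proof.
split=> [j|j j1|j j2|j j2|j k j2 jk].
- exact: omegaN.
- by split; [exact: omega_convex|exact: omega_convex_gt0].
- exact: omega_neq0.
- exact: omega_gt0.
- exact: omega_lt.
Qed.
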